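(* For each integer $n\ge0$ and each $z\in\mathbb{C}\setminus\{\frac14\}$, $$G_n(z)=\frac{s_2(z)^{n+1}-s_1(z)^{n+1}}{s_2(z)-s_1(z)},$$ where $s_1(z)=\frac{1-\sqrt{1-4z}}{2}$ and $s_2(z)=\frac{1+\sqrt{1-4z}}{2}$.
   Context: The polynomials $G_n$ are defined for $z\in\mathbb{C}$ by $G_0(z)=G_1(z)=1$ and $G_n(z)=G_{n-1}(z)-zG_{n-2}(z)$ for $n\ge 2$. $\sqrt{1-4z}$ is a fixed square root of $1-4z$ (the same one in $s_1$ and $s_2$). *)

(* Defs.v *)
From mathcomp Require Import all_boot all_order all_algebra.
From mathcomp Require Import reals complex.

Set Implicit Arguments.
Unset Strict Implicit.
Unset Printing Implicit Defensive.

Import GRing.Theory.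
Local Open Scope ring_scope.

Fixpoint G (R : realType) (n : nat) : {poly R[i]} :=
  match n with
  | 0 => 1
  | n'.+1 => match n' with
             | 0 => 1
             | n''.+1 => G R n' - 'X * G R n''
             end
  end.

Lemma horner_G0 (R : realType) (z : R[i]) : (G R 0).[z] = 1.
Proof. by rewrite /= hornerC. Qed.

Lemma horner_G1 (R : realType) (z : R[i]) : (G R 1).[z] = 1.
Proof. by rewrite /= hornerC. Qed.

Lemma horner_GSS (R : realType) (n : nat) (z : R[i]) :
  (G R n.+2).[z] = (G R n.+1).[z] - z * (G R n).[z].
Proof. by rewrite [G R n.+2]/= !hornerE. Qed.

(* s_1(z) and s_2(z) as functions of a chosen square root w of 1 - 4 z, so that
   no particular branch of the square root is imposed. *)
Definition s1 (R : realType) (w : R[i]) : R[i] := (1 - w) / 2.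
Definition s2 (R : realType) (w : R[i]) : R[i] := (1 + w) / 2.

(* Main.v *)
(* s_1(z) and s_2(z) are the roots of s^2 = s - z, so s_2^(n+1) - s_1^(n+1) obeys
   the recurrence of G_n; it equals s_2 - s_1 = sqrt(1 - 4z) for n = 0 and n = 1,
   which is nonzero exactly when z <> 1/4. *)
Require Import Defs.
From mathcomp Require Import all_boot all_order all_algebra.
From mathcomp Require Import reals complex.
From mathcomp Require Import ring.

Set Implicit Arguments.
Unset Strict Implicit.
Unset Printing Implicit Defensive.

Import GRing.Theory.
Local Open Scope ring_scope.

Lemma s1E (R : realType) (w : R[i]) : s1 w = s2 (- w).
Proof. by []. Qed.

Lemma s2_sub_s1 (R : realType) (w : R[i]) : s2 w - s1 w = w.
Proof.
have two_neq0 : (2 : R[i]) != 0 by rewrite Num.Theory.pnatr_eq0.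
by rewrite /s1 /s2; field.
Qed.

Lemma s2_sqr (R : realType) (z w : R[i]) :
  w ^+ 2 = 1 - 4 * z -> s2 w ^+ 2 = s2 w - z.
Proof.
move=> hw.
have two_neq0 : (2 : R[i]) != 0 by rewrite Num.Theory.pnatr_eq0.
have -> : s2 w ^+ 2 = (1 + 2 * w + w ^+ 2) / 4 by rewrite /s2; field.
by rewrite hw /s2; field.
Qed.

Lemma s1_sqr (R : realType) (z w : R[i]) :
  w ^+ 2 = 1 - 4 * z -> s1 w ^+ 2 = s1 w - z.
Proof. by move=> hw; rewrite s1E; apply: s2_sqr; rewrite sqrrN. Qed.

Lemma horner_G_mul (R : realType) (n : nat) (z w : R[i]) :
  w ^+ 2 = 1 - 4 * z ->
  (G R n).[z] * (s2 w - s1 w) = s2 w ^+ n.+1 - s1 w ^+ n.+1.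
Proof.
move=> hw; have h2 := s2_sqr hw; have h1 := s1_sqr hw.
elim/ltn_ind: n => -[|[|n]] IH.
- by rewrite horner_G0 mul1r !expr1.
- by rewrite horner_G1 mul1r h1 h2; ring.
- rewrite horner_GSS mulrBl -mulrA !IH //.
  have powSS s : s ^+ 2 = s - z -> s ^+ n.+3 = s ^+ n.+2 - z * s ^+ n.+1.
    by move=> hs; rewrite -[n.+3]/(2 + n.+1)%N exprD hs mulrBl -exprS.
  by rewrite (powSS _ h1) (powSS _ h2); ring.
Qed.

Theorem corollary4 (R : realType) (n : nat) (z w : R[i])
    (hz : z <> 1 / 4) (hw : w ^+ 2 = 1 - 4 * z) :
  (G R n).[z] = (s2 w ^+ n.+1 - s1 w ^+ n.+1) / (s2 w - s1 w).
Proof.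
have four_neq0 : (4 : R[i]) != 0 by rewrite Num.Theory.pnatr_eq0.
rewrite -(horner_G_mul n hw) mulfK // s2_sub_s1.
apply/eqP => w0; apply: hz; move/eqP: hw.
rewrite w0 expr0n /= eq_sym subr_eq0 => /eqP one_eq.
by apply: (mulfI four_neq0); rewrite -one_eq mul1r divff.
Qed.
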